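(* Let $(\Gamma,x_0)$ be a rooted inverse $\widetilde{A}$-digraph that is context-free. Then $\Gamma$ is quasi-isometric to a tree.
   Context: $A$ is a finite set, $\widetilde{A}=A\cup A^{-1}$ with $A^{-1}$ a disjoint set of formal inverses. An inverse $\widetilde{A}$-digraph consists of vertices, oriented edges with initial and terminal maps $\iota,\tau$, a labeling $\lambda$ of edges by $\widetilde{A}$, and an involution $e\mapsto e^{-1}$ on edges with $e\neq e^{-1}$, $\iota(e^{-1})=\tau(e)$, $\tau(e^{-1})=\iota(e)$, $\lambda(e^{-1})=\lambda(e)^{-1}$, such that the graph is connected and deterministic (at most one edge with a given label starts at a given vertex). The rooted graph $(\Gamma,x_0)$ is context-free if the set $L(\Gamma,x_0)\subseteq\widetilde{A}^*$ of labels of all walks from $x_0$ to $x_0$ is a context-free language. $\Gamma$ is a metric space via the path distance on vertices. A quasi-isometry between metric spaces $(X_1,d_1),(X_2,d_2)$ is a map $\psi:X_1\to X_2$ with positive constants $k,K,c,C,N$ such that $k\,d_1(x,y)-c\le d_2(\psi(x),\psi(y))\le K\,d_1(x,y)+C$ for all $x,y\in X_1$ and every $z\in X_2$ is within distance $N$ of some $\psi(x)$. *)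

(* Defs.v *)
From HB Require Import structures.
From Stdlib Require Import Relation_Operators.
From mathcomp Require Import all_boot all_order all_algebra.
From mathcomp Require Import boolp classical_sets reals topology.

Set Implicit Arguments.
Unset Strict Implicit.
Unset Printing Implicit Defensive.

Import Order.TTheory GRing.Theory Num.Theory.

Local Open Scope classical_set_scope.

(* Symbols are nonterminals ([inl]) or terminals ([inr]). *)
Record cfg (S : finType) := Cfg {
  nonterminal : finType;
  start : nonterminal;
  rules : seq (nonterminal * seq (nonterminal + S)) }.

Section Grammar.
Variables (S : finType) (g : cfg S).
Implicit Types u v l r : seq (nonterminal g + S).

Definition cfg_step u v : Prop :=
  exists l r X s, [/\ (X, s) \in rules g, u = l ++ inl X :: r & v = l ++ s ++ r].

Definition cfg_derives : seq (nonterminal g + S) -> seq (nonterminal g + S) -> Prop :=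
  clos_refl_trans _ cfg_step.

Definition cfg_language : set (seq S) :=
  [set w | cfg_derives [:: inl (start g)] (map inr w)].

End Grammar.

Definition context_free (S : finType) (L : set (seq S)) : Prop :=
  exists g : cfg S, L = cfg_language g.

Record graph := Graph {
  vertex : choiceType;
  edge : choiceType;
  ini : edge -> vertex;
  ter : edge -> vertex;
  einv : edge -> edge;
  einvK : involutive einv;
  einv_neq : forall e, einv e != e;
  ini_einv : forall e, ini (einv e) = ter e;
  ter_einv : forall e, ter (einv e) = ini e }.

Arguments ini {g}.
Arguments ter {g}.
Arguments einv {g}.

Fixpoint walk (G : graph) (x : vertex G) (p : seq (edge G)) (y : vertex G) : bool :=
  if p is e :: p' then (ini e == x) && walk (ter e) p' y else x == y.

Definition connected_graph (G : graph) : Prop :=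
  forall x y : vertex G, exists p, walk x p y.

(* A circuit visits pairwise distinct vertices and never backtracks; lengths 1
   (loops) and 2 (a pair of parallel edges) are allowed. *)
Definition circuit (G : graph) (p : seq (edge G)) : Prop :=
  [/\ p != [::],
      exists x, walk x p x,
      uniq (map ter p) &
      sorted (fun e f => f != einv e) p].

Record cgraph := CGraph {
  cgraph_graph :> graph;
  cgraph_connected : connected_graph cgraph_graph }.

Record tree := Tree {
  tree_cgraph :> cgraph;
  tree_acyclic : forall p : seq (edge tree_cgraph), ~ circuit p }.

Section PathDistance.
Variable G : cgraph.
Implicit Types x y z : vertex G.

Definition walk_length x y : pred nat :=
  fun n => `[< exists2 p, walk x p y & size p = n >].

Lemma walk_length_ex x y : exists n, walk_length x y n.
Proof.
have [p xpy] := @cgraph_connected G x y.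
by exists (size p); apply/asboolP; exists p.
Qed.

Definition path_dist x y : nat := ex_minn (walk_length_ex x y).

Lemma path_dist_le x y p : walk x p y -> path_dist x y <= size p.
Proof.
move=> xpy; rewrite /path_dist; case: ex_minnP => n _; apply.
by apply/asboolP; exists p.
Qed.

Lemma path_dist_walk x y : exists2 p, walk x p y & size p = path_dist x y.
Proof. by rewrite /path_dist; case: ex_minnP => n /asboolP. Qed.

Lemma walk_cat x p y q z : walk x p y -> walk y q z -> walk x (p ++ q) z.
Proof.
elim: p x => [|e p IHp] x /=; first by move=> /eqP ->.
by move=> /andP[-> /IHp]; apply.
Qed.

Lemma walk_rev x p y : walk x p y -> walk y (rev (map einv p)) x.
Proof.
elim: p x => [|e p IHp] x /=; first by rewrite eq_sym.
move=> /andP[/eqP <- /IHp py]; rewrite rev_cons -cats1.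
by apply: walk_cat py _; rewrite /= ini_einv ter_einv !eqxx.
Qed.

Lemma path_distxx x : path_dist x x = 0.
Proof. by apply/eqP; rewrite -leqn0 (@path_dist_le _ _ [::]) /=. Qed.

Lemma path_dist_eq0 x y : path_dist x y = 0 -> x = y.
Proof.
have [p xpy <-] := path_dist_walk x y.
by move=> /size0nil p0; move: xpy; rewrite p0 => /eqP.
Qed.

Lemma path_dist_sym x y : path_dist x y = path_dist y x.
Proof.
have le a b : path_dist a b <= path_dist b a.
  have [p /walk_rev bpa <-] := path_dist_walk b a.
  by have := path_dist_le bpa; rewrite size_rev size_map.
by apply/eqP; rewrite eqn_leq !le.
Qed.

Lemma path_dist_triangle y x z :
  path_dist x z <= path_dist x y + path_dist y z.
Proof.
have [p xpy <-] := path_dist_walk x y; have [q yqz <-] := path_dist_walk y z.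
by rewrite -size_cat path_dist_le // (walk_cat xpy).
Qed.

End PathDistance.

Local Open Scope ring_scope.

Definition path_space (R : realType) (G : cgraph) : Type := vertex G.

Section PathSpace.
Variables (R : realType) (G : cgraph).
Implicit Types x y z : vertex G.

Let d x y : R := (path_dist x y)%:R.

Let dxx x : d x x = 0.
Proof. by rewrite /d path_distxx. Qed.

Let d_eq0 x y : d x y = 0 -> x = y.
Proof. by move=> /eqP; rewrite pnatr_eq0 => /eqP /path_dist_eq0. Qed.

Let d_sym x y : d x y = d y x.
Proof. by rewrite /d path_dist_sym. Qed.

Let d_triangle y x z : d x z <= d x y + d y z.
Proof. by rewrite /d -natrD ler_nat path_dist_triangle. Qed.

HB.instance Definition _ := Choice.on (path_space R G).
HB.instance Definition _ :=
  isMetric.Build R (path_space R G) dxx d_eq0 d_sym d_triangle.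

End PathSpace.

Lemma mdist_path_space (R : realType) (G : cgraph) (x y : path_space R G) :
  mdist x y = (path_dist (x : vertex G) y)%:R.
Proof. by []. Qed.

Definition quasi_isometry (R : realType) (X1 X2 : metricType R)
    (psi : X1 -> X2) : Prop :=
  exists k K c C N : R,
    [/\ [/\ 0 < k, 0 < K, 0 < c, 0 < C & 0 < N],
        forall x y : X1,
          k * mdist x y - c <= mdist (psi x) (psi y) <= K * mdist x y + C &
        forall z : X2, exists x : X1, mdist z (psi x) <= N].

Definition quasi_isometric (R : realType) (X1 X2 : metricType R) : Prop :=
  exists psi : X1 -> X2, quasi_isometry psi.

(* [inl a] is the letter [a] and [inr a] its formal inverse. *)
Definition letter (A : finType) : finType := (A + A)%type.

Definition letter_inv (A : finType) (l : letter A) : letter A :=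
  match l with inl a => inr a | inr a => inl a end.

Record inverse_digraph (A : finType) := InverseDigraph {
  idg_cgraph :> cgraph;
  label : edge idg_cgraph -> letter A;
  label_einv : forall e, label (einv e) = letter_inv (label e);
  deterministic : forall e f, ini e = ini f -> label e = label f -> e = f }.

Definition loop_language (A : finType) (G : inverse_digraph A) (x0 : vertex G) :
    set (seq (letter A)) :=
  [set map (@label A G) p | p in [set p | walk x0 p x0]].

(* Main.v *)
(* Let [lev v] be the distance from [x0] to [v].  The vertices of the tree are the
   classes of vertices that have the same level [n] and lie in the same component
   of [{lev >= n}]; the parent of a class is the class of any lower neighbour.
   The projection is onto and 1-Lipschitz, and it is a quasi-isometry as soon as
   the classes have uniformly bounded diameter [D].

   Such a [D] comes from the grammar.  If a nonterminal [X] covers the part of a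
   closed walk between [a] and [b], any word derived from [X] may be substituted
   there and, by determinism, still leads from [a] to [b]; hence [a] and [b] are
   within a distance depending on [X] only.  For [v] and [w] in one class, take
   the closed walk made of a geodesic from [x0] to [v], a walk from [v] to [w] in
   [{lev >= n}] and a geodesic from [w] to [x0].  A lowest node of its parse tree
   that covers the middle part gives a vertex of the middle part that is close to
   a vertex of each geodesic; as its level is at least [n], these two vertices
   are close to [v] and to [w]. *)
From Stdlib Require Import Relation_Operators Operators_Properties.
Require Import Defs.
From mathcomp Require Import all_boot all_order all_algebra.
From mathcomp Require Import boolp classical_sets reals topology.
From mathcomp Require Import zify.

Set Implicit Arguments.
Unset Strict Implicit.
Unset Printing Implicit Defensive.

Import GRing.Theory Num.Theory.

(** * Cutting walks at a position or at a vertex *)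

Section Walks.
Variable G : graph.
Implicit Types (x y z : vertex G) (p q : seq (edge G)).

Lemma walk_last x p y : walk x p y -> last x (map ter p) = y.
Proof. by elim: p x => [|e p IHp] x /=; [move=> /eqP | move=> /andP[_ /IHp]]. Qed.

Lemma walk_catE x p q z :
  walk x (p ++ q) z =
  walk x p (last x (map ter p)) && walk (last x (map ter p)) q z.
Proof.
by elim: p x => [|e p IHp] x /=; rewrite ?eqxx // IHp andbA.
Qed.

Lemma walk_mem_split x p y z : walk x p y -> z \in x :: map ter p ->
  exists q r, [/\ p = q ++ r, walk x q z & walk z r y].
Proof.
elim: p x => [|e p IHp] x /=.
  move=> xy; rewrite inE => /eqP->.
  by exists [::], [::]; rewrite /= xy eqxx.
move=> /andP[/eqP ex py]; rewrite inE => /predU1P[->|/(IHp _ py)[q [r [-> qz rz]]]].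
  by exists [::], (e :: p); split; rewrite //= ?ex ?eqxx.
by exists (e :: q), r; split; rewrite //= ex eqxx.
Qed.

End Walks.

(** * The tree defined by a level and a parent function *)

Section RootedForest.
Variables (V : choiceType) (level : V -> nat) (parent : V -> V).
Hypothesis level_parent : forall t, 0 < level t -> (level (parent t)).+1 = level t.

(** One pair of mutually inverse edges per vertex of positive level; the boolean [true] orients it
    towards the parent. *)
Definition forest_edge : choiceType := ({t : V | 0 < level t} * bool)%type.
Implicit Types e f : forest_edge.

Definition forest_ini e := if e.2 then val e.1 else parent (val e.1).
Definition forest_ter e := if e.2 then parent (val e.1) else val e.1.
Definition forest_inv e : forest_edge := (e.1, ~~ e.2).

Fact forest_invK : involutive forest_inv.
Proof. by case=> t b; rewrite /forest_inv /= negbK. Qed.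

Fact forest_inv_neq e : forest_inv e != e.
Proof. by case: e => t b; rewrite xpair_eqE /= eqxx; case: b. Qed.

Fact forest_ini_inv e : forest_ini (forest_inv e) = forest_ter e.
Proof. by case: e => t []. Qed.

Fact forest_ter_inv e : forest_ter (forest_inv e) = forest_ini e.
Proof. by case: e => t []. Qed.

Definition forest : graph :=
  Graph forest_invK forest_inv_neq forest_ini_inv forest_ter_inv.

Lemma parent_walks t : 0 < level t ->
  exists e e', walk (G := forest) t [:: e] (parent t) /\
               walk (G := forest) (parent t) [:: e'] t.
Proof.
move=> t0; exists (exist _ t t0, true), (exist _ t t0, false).
by rewrite /= /forest_ini /forest_ter /= !eqxx.
Qed.

Lemma forest_connected : (forall t t', level t = 0 -> level t' = 0 -> t = t') ->
  connected_graph forest.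
Proof.
move=> root_uniq x y.
have [n] := ubnP (level x + level y); elim: n x y => // n IHn x y.
have [x0|x0] := posnP (level x); last first.
  move=> lt_n; have [e [_ [/andP[xe /eqP ex] _]]] := parent_walks x0.
  have [|p px] := IHn (parent x) y.
    by move: lt_n; rewrite -(level_parent x0) addSn ltnS.
  by exists (e :: p); rewrite /= xe [forest_ter e]ex.
have [y0 _|y0] := posnP (level y).
  by exists [::]; rewrite /= (root_uniq x y).
move=> lt_n; have [_ [e [_ ye]]] := parent_walks y0.
have [|p px] := IHn x (parent y).
  by move: lt_n; rewrite -(level_parent y0) addnS ltnS.
by exists (p ++ [:: e]); rewrite walk_catE (walk_last px) px.
Qed.

Let nobacktrack : rel forest_edge := fun e f => f != forest_inv e.

(** A downward edge ends at its own child vertex and an upward edge starts at its own, so turning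
    from down to up retraces the same edge. *)
Let ascending_step e f :
  forest_ini f = forest_ter e -> nobacktrack e f -> f.2 -> e.2.
Proof.
move=> ief ef f2; apply: contraNT ef => e2; apply/eqP.
case: e f f2 ief e2 => [t []] [t' []] // _ tt' _.
by congr pair; apply: val_inj.
Qed.

Let ascending_head x e p y : walk (G := forest) x (e :: p) y ->
  path nobacktrack e p -> (last e p).2 -> e.2.
Proof.
elim: p x e => // f p IHp x e /andP[_ fp] /= /andP[ef pf] lastp.
have f2 := IHp _ _ fp pf lastp.
by apply: ascending_step ef f2; case/andP: fp => /eqP.
Qed.

Let ascending x e p y : walk (G := forest) x (e :: p) y ->
  path nobacktrack e p -> (last e p).2 -> level y < level x.
Proof.
elim: p x e => [|f p IHp] x e xp ep lastp; have e2 := ascending_head xp ep lastp.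
  move: xp; rewrite /= /forest_ini /forest_ter e2 => /andP[/eqP <- /eqP <-].
  by rewrite level_parent ?(valP e.1).
move: xp => /andP[/eqP <- fp]; move: ep => /= /andP[_ pf].
apply: ltn_trans (IHp _ _ fp pf lastp) _.
by rewrite /= /forest_ini /forest_ter e2 level_parent ?(valP e.1).
Qed.

Let descending x e p y : walk (G := forest) x (e :: p) y ->
  path nobacktrack e p -> ~~ e.2 -> level x < level y.
Proof.
elim: p x e => [|f p IHp] x e xp ep e2.
  move: xp; rewrite /= /forest_ini /forest_ter (negPf e2) => /andP[/eqP <- /eqP <-].
  by rewrite level_parent ?(valP e.1).
have f2 : ~~ f.2.
  move: ep => /= /andP[ef _]; apply: contraNN e2; apply: ascending_step ef.
  by case/and3P: xp => _ /eqP.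
move: xp => /andP[/eqP <- fp]; move: ep => /= /andP[_ pf].
apply: leq_trans (IHp _ _ fp pf f2).
by rewrite /= /forest_ini /forest_ter (negPf e2) ltnS ltnW // level_parent ?(valP e.1).
Qed.

(* Without backtracking, a walk never goes up after having gone down, so a
   circuit starts by going up and ends by going down along the same edge. *)
Lemma forest_acyclic (p : seq (edge forest)) : ~ circuit p.
Proof.
case: p => [[] //|e p] [_ [x xp] uniq_ter bt].
have e2 : e.2 by apply: contraT => e2; have := descending xp bt e2; rewrite ltnn.
case: (lastP p) xp uniq_ter bt => [|q f] xp uniq_ter bt.
  by have := ascending xp bt e2; rewrite ltnn.
have f2 : ~~ f.2.
  by apply/negP => f2; have := ascending xp bt; rewrite last_rcons ltnn => /(_ f2).
have fe : f = forest_inv e.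
  have := walk_last xp; rewrite /= map_rcons last_rcons => tf.
  have /andP[/eqP ie _] := xp; rewrite -tf in ie.
  case: e f e2 f2 ie {xp uniq_ter bt tf} => [t []] [t' []] //= _ _ tt'.
  by congr pair; apply: val_inj.
move: xp; rewrite -cats1 /= walk_catE => /and3P[_ qe].
rewrite fe /= andbC => /andP[_ /eqP ter_q].
(* If [q] is empty, [e] is retraced at once; otherwise [q] ends where [e] ends, and that vertex is
   repeated. *)
case: (lastP q) qe ter_q uniq_ter bt => [_ _ _ | r h _].
  by rewrite fe /= => /andP[/eqP].
rewrite map_rcons last_rcons forest_ini_inv => ter_q /=.
by rewrite ter_q !map_rcons !mem_rcons inE mem_rcons inE eqxx orbT.
Qed.

End RootedForest.

(** * Derived words and the bound on the frontiers *)

Section Yields.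
Variables (S : finType) (g : cfg S).
Implicit Types (s t : seq (nonterminal g + S)) (u w : seq S).

(** Parse forests: induction follows the tree structure instead of the order of the rewriting
    steps. *)
Inductive yields : seq (nonterminal g + S) -> seq S -> Prop :=
| yields_nil : yields [::] [::]
| yields_terminal a s w : yields s w -> yields (inr a :: s) (a :: w)
| yields_nonterminal X r s u w :
    (X, r) \in rules g -> yields r u -> yields s w -> yields (inl X :: s) (u ++ w).

Lemma yields_cat s t u w : yields s u -> yields t w -> yields (s ++ t) (u ++ w).
Proof.
move=> su tw; elim: su => //= [a r v _ IHr | X r r' v v' Xr rv _ _ IHr'].
  exact: yields_terminal.
by rewrite -catA; apply: yields_nonterminal Xr rv IHr'.
Qed.

Lemma yields_catI s t w : yields (s ++ t) w ->
  exists u v, [/\ w = u ++ v, yields s u & yields t v].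
Proof.
elim: s w => [|x s IHs] w /=.
  by exists [::], w; split=> //; apply: yields_nil.
move=> xsw; inversion xsw as [|a r v rv |X r r' v v' Xr rv r'v'].
  have [u [v' [-> su tv]]] := IHs _ rv.
  by exists (a :: u), v'; split=> //; apply: yields_terminal.
have [u [u' [-> su tu']]] := IHs _ r'v'.
exists (v ++ u), u'; rewrite catA; split=> //.
exact: yields_nonterminal Xr rv su.
Qed.

Lemma yields_map_inr w : yields (map inr w) w.
Proof. by elim: w => [|a w IHw]; [apply: yields_nil | apply: yields_terminal]. Qed.

Lemma yields_rule X r u : (X, r) \in rules g -> yields r u -> yields [:: inl X] u.
Proof.
by move=> Xr ru; rewrite -[u]cats0; apply: yields_nonterminal Xr ru yields_nil.
Qed.

Lemma cfg_derives_context l r s t :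
  cfg_derives s t -> cfg_derives (l ++ s ++ r) (l ++ t ++ r).
Proof.
elim=> {s t} [s t [l' [r' [X [v [Xv -> ->]]]]] | s | s s' t _ IHs _ IHt].
- apply: rt_step; exists (l ++ l'), (r' ++ r), X, v; split=> //.
    by rewrite -!catA.
  by rewrite -!catA.
- exact: rt_refl.
- exact: rt_trans IHs IHt.
Qed.

Lemma cfg_derives_yields s w : cfg_derives s (map inr w) <-> yields s w.
Proof.
split=> [/clos_rt_rt1n_iff sw | ].
  elim: {s}sw {-2}w (erefl (map inr w : seq (nonterminal g + S)))
    => [s u <- | s s' t ss' _ IHs v vt].
    exact: yields_map_inr.
  have := IHs v vt; move: ss' => [l [r [X [z [Xz -> ->]]]]].
  move=> /yields_catI[u [u' [-> lu /yields_catI[zu [u'' [-> zzu ru]]]]]].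
  by apply: yields_cat lu _; apply: yields_nonterminal Xz zzu ru.
elim=> [|a t v _ IHt|X r t u v Xr _ IHr _ IHt]; first exact: rt_refl.
  by have := cfg_derives_context [:: inr a] [::] IHt; rewrite !cats0.
apply: (rt_trans _ _ _ (r ++ t)).
  by apply: rt_step; exists [::], t, X, r.
rewrite map_cat; apply: (rt_trans _ _ _ (map inr u ++ t)).
  exact: (cfg_derives_context [::] t IHr).
by have := cfg_derives_context (map inr u) [::] IHt; rewrite !cats0.
Qed.

End Yields.

(** * Words read along walks, and what determinism forces *)

Section Reads.
Variables (A : finType) (G : inverse_digraph A).
Implicit Types (a b c : vertex G) (u w : seq (letter A)).

Definition reads a w b : Prop := exists2 p, walk a p b & map (@label A G) p = w.

Lemma reads_cat a u b w c : reads a u b -> reads b w c -> reads a (u ++ w) c.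
Proof.
move=> [p ap <-] [q bq <-]; exists (p ++ q); rewrite ?map_cat //.
exact: walk_cat ap bq.
Qed.

Lemma reads_catI a u w c : reads a (u ++ w) c ->
  exists2 b, reads a u b & reads b w c.
Proof.
move=> [p apc puw].
have pE : p = take (size u) p ++ drop (size u) p by rewrite cat_take_drop.
move: apc; rewrite pE walk_catE => /andP[ap pc].
exists (last a (map ter (take (size u) p))).
  by exists (take (size u) p); rewrite // map_take puw take_size_cat.
by exists (drop (size u) p); rewrite // map_drop puw drop_size_cat.
Qed.

Lemma reads_inj a w b c : reads a w b -> reads a w c -> b = c.
Proof.
move=> [p ab <-] [q ac]; elim: p q a ab ac => [|e p IHp] [|f q] a //=.
  by move=> /eqP-> /eqP.
move=> /andP[/eqP ea pb] /andP[/eqP fa qc] [lfe lqp].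
have fe := @deterministic _ _ f e (etrans fa (esym ea)) lfe.
by apply: (IHp q (ter e)) lqp => //; rewrite -fe.
Qed.

Lemma reads_rev a w b : reads a w b -> reads b (rev (map (@letter_inv A) w)) a.
Proof.
move=> [p /walk_rev ap <-]; exists (rev (map einv p)) => //.
by rewrite map_rev -!map_comp; congr rev; apply: eq_map => e /=; rewrite label_einv.
Qed.

(** Inverse edges make the graph deterministic backwards as well. *)
Lemma reads_injl a b w c : reads a w c -> reads b w c -> a = b.
Proof. by move=> /reads_rev ca /reads_rev; apply: reads_inj. Qed.

Lemma reads_dist a w b : reads a w b -> path_dist a b <= size w.
Proof. by move=> [p /path_dist_le ab <-]; rewrite size_map. Qed.

Variable g : cfg (letter A).
Implicit Types s t : seq (nonterminal g + letter A).

(* [s] may occur between [a] and [b] in a parse tree of the label of a closed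
   walk: each word derived from [s] could be substituted there. *)
Definition spans s a b : Prop := forall u, yields s u -> reads a u b.

(** One factor is varied while the other keeps its word; determinism along the fixed word, backwards
    or forwards, forces the cut to stay at [b]. *)
Lemma spans_cat s t u w a b c : spans (s ++ t) a c ->
  yields s u -> reads a u b -> yields t w -> reads b w c ->
  spans s a b /\ spans t b c.
Proof.
move=> st su aub tw bwc; split=> v yv.
  have [d ad dc] := reads_catI (st _ (yields_cat yv tw)).
  by rewrite (reads_injl bwc dc).
have [d ad dc] := reads_catI (st _ (yields_cat su yv)).
by rewrite (reads_inj aub ad).
Qed.

Lemma spans_rule X r a b : (X, r) \in rules g -> spans [:: inl X] a b -> spans r a b.
Proof. by move=> Xr Xab u /(yields_rule Xr)/Xab. Qed.

(** A single word derived from a symbol can be read between any two vertices that the symbol spans,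
    so its length bounds all these distances. *)
Lemma spans_symbol_bounded : exists2 K, 0 < K &
  forall x a b u, yields [:: x] u -> spans [:: x] a b -> path_dist a b <= K.
Proof.
have /choice[k kP] (X : nonterminal g) : exists k, forall a b u,
    yields [:: inl X] u -> spans [:: inl X] a b -> path_dist a b <= k.
  have [[w Xw]|noX] := pselect (exists w, yields [:: inl X] w).
    by exists (size w) => a b _ _ Xab; apply/reads_dist/Xab.
  by exists 0 => a b u Xu; case: noX; exists u.
(* The successor covers the terminals, which span one edge, and makes the bound positive. *)
exists (\max_X k X).+1 => // -[X|l] a b u xu xab.
  by apply/leqW/(leq_trans (kP _ _ _ _ xu xab))/leq_bigmax.
apply: (@leq_trans 1) => //.
by apply: (@reads_dist _ [:: l]); apply: xab; apply: yields_terminal (yields_nil _).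
Qed.

(** * Three nearby points on a walk cut into three pieces *)

Section ThreePoints.
Variables (K M : nat).
Hypothesis K_gt0 : 0 < K.
Hypothesis dist_symbol :
  forall x a b u, yields [:: x] u -> spans [:: x] a b -> path_dist a b <= K.

Lemma spans_dist s a b u : yields s u -> spans s a b -> path_dist a b <= K * size s.
Proof.
elim: s a u => [|x s IHs] a u su sab.
  by rewrite muln0; apply: reads_dist (sab _ (yields_nil _)).
have [v [w [uvw xv sw]]] := @yields_catI _ _ [:: x] s u su.
have [c avc cwb] := reads_catI (sab _ (yields_cat xv sw)).
have [xac scb] := @spans_cat [:: x] s _ _ _ _ _ sab xv avc sw cwb.
rewrite mulnS (leq_trans (path_dist_triangle c _ _)) // leq_add //.
  exact: dist_symbol xv xac.
exact: IHs sw scb.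
Qed.

Let three_points s u := forall a v v' b p1 p2 p3,
  K * size s <= M -> spans s a b -> walk a p1 v -> walk v p2 v' -> walk v' p3 b ->
  map (@label A G) (p1 ++ p2 ++ p3) = u ->
  exists i m j, [/\ [/\ i \in a :: map ter p1, m \in v :: map ter p2
                      & j \in v' :: map ter p3],
                    path_dist i m <= M & path_dist m j <= M].

(** The whole walk has length at most [size s <= K * size s <= M], so any points on it will do. *)
Let three_points_short s u : yields s u -> size u <= size s -> three_points s u.
Proof.
move=> su us a v v' b p1 p2 p3 sM sab p1v p2w p3b defu.
have uM : size (p1 ++ p2 ++ p3) <= M.
  rewrite -(size_map (@label A G)) defu (leq_trans us) // (leq_trans _ sM) //.
  by rewrite leq_pmull.
exists a, v, v'; split; first by rewrite !mem_head.
  by rewrite (leq_trans (path_dist_le p1v)) // (leq_trans _ uM) // size_cat leq_addr.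
rewrite (leq_trans (path_dist_le p2w)) // (leq_trans _ uM) // !size_cat.
by rewrite addnCA leq_addr.
Qed.

Let mem_walk_suffix a q r c (z : vertex G) :
  walk a q c -> z \in c :: map ter r -> z \in a :: map ter (q ++ r).
Proof.
move=> /walk_last <-; rewrite inE map_cat -cat_cons mem_cat => /predU1P[->|->].
  by rewrite mem_last.
by rewrite orbT.
Qed.

Let mem_walk_prefix a q r (z : vertex G) :
  z \in a :: map ter q -> z \in a :: map ter (q ++ r).
Proof. by rewrite map_cat -cat_cons mem_cat => ->. Qed.

(** Let [c] be the vertex reached after [u]. If [c] lies on [p1], all of [p2] is covered by [s]; if
    on [p3], by [x]; in both cases induction applies. If [c] lies on [p2], it is the middle point,
    close to both ends [a] and [b]. *)
Let three_points_cons x s u w : yields [:: x] u -> yields s w ->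
  three_points [:: x] u -> three_points s w -> three_points (x :: s) (u ++ w).
Proof.
move=> xu sw IHx IHs a v v' b p1 p2 p3 sM sab p1v p2v' p3b defuw.
have split_label q r : map (@label A G) (q ++ r) = u ++ w -> size q = size u ->
    map (@label A G) q = u /\ map (@label A G) r = w.
  by rewrite map_cat => /eqP + qu; rewrite eqseq_cat ?size_map // => /andP[/eqP-> /eqP->].
have split_spans q r c : map (@label A G) (q ++ r) = u ++ w -> size q = size u ->
    walk a q c -> walk c r b -> spans [:: x] a c /\ spans s c b.
  move=> /split_label + qu ac cb => /(_ qu)[lq lr].
  by apply: (@spans_cat [:: x] s u w) => //; [exists q | exists r].
have xM : K * size [:: x] <= M by apply: leq_trans sM; rewrite leq_pmul2l.
have {}sM : K * size s <= M by apply: leq_trans sM; rewrite leq_pmul2l //= leqnSn.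
have split_walk n p (y z : vertex G) : walk y p z -> n <= size p ->
    exists q r c, [/\ p = q ++ r, size q = n, walk y q c & walk c r z].
  move=> yz np; exists (take n p), (drop n p), (last y (map ter (take n p))).
  move: yz; rewrite -{1}(cat_take_drop n p) walk_catE => /andP[-> ->].
  by rewrite cat_take_drop size_takel.
have [le_u_p1|lt_p1_u] := leqP (size u) (size p1).
  have [q [r [c [p1E qu ac cv]]]] := split_walk _ _ _ _ p1v le_u_p1.
  move: defuw; rewrite p1E -catA => defuw.
  have [_ lw] := split_label _ _ defuw qu.
  have [_ scb] :=
    split_spans _ _ c defuw qu ac (walk_cat cv (walk_cat p2v' p3b)).
  have [i [m [j [[ir mp jp] im mj]]]] := IHs _ _ _ _ _ _ _ sM scb cv p2v' p3b lw.
  by exists i, m, j; split=> //; split=> //; apply: mem_walk_suffix ac ir.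
have [le_u_p12|lt_p12_u] := leqP (size u) (size p1 + size p2).
  have [|q [r [c [p2E qu vc cv']]]] := split_walk (size u - size p1) _ _ _ p2v'.
    by rewrite leq_subLR.
  have [||||xac scb] := split_spans (p1 ++ q) (r ++ p3) c.
  - by rewrite -defuw p2E -!catA.
  - by rewrite size_cat qu subnKC // ltnW.
  - exact: walk_cat p1v vc.
  - exact: walk_cat cv' p3b.
  exists a, c, b; split.
  - rewrite mem_head p2E; split=> //; last by rewrite -(walk_last p3b) mem_last.
    by apply: mem_walk_suffix vc _; rewrite mem_head.
  - by apply: leq_trans xM; rewrite muln1; apply: dist_symbol xu xac.
  - exact: leq_trans (spans_dist sw scb) sM.
have le_u_p3 : size u - (size p1 + size p2) <= size p3.
  rewrite leq_subLR; have /(congr1 size) := defuw.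
  by rewrite size_map !size_cat addnA => ->; rewrite leq_addr.
have [q [r [c [p3E qu v'c cb]]]] := split_walk _ _ _ _ p3b le_u_p3.
have ac : walk a (p1 ++ p2 ++ q) c by apply: walk_cat p1v (walk_cat p2v' v'c).
have pqr : map (@label A G) ((p1 ++ p2 ++ q) ++ r) = u ++ w.
  by rewrite -defuw p3E -!catA.
have size_pq : size (p1 ++ p2 ++ q) = size u.
  by rewrite !size_cat qu addnA subnKC // ltnW.
have [lu _] := split_label _ _ pqr size_pq.
have [xac _] := split_spans _ _ _ pqr size_pq ac cb.
have [i [m [j [[ip mp jq] im mj]]]] := IHx _ _ _ _ _ _ _ xM xac p1v p2v' v'c lu.
exists i, m, j; split=> //; split=> //.
by rewrite p3E; apply: mem_walk_prefix jq.
Qed.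

(* A lowest node of the parse tree that covers the middle part of the walk has
   two consecutive children separated at a vertex of that middle part. *)
Lemma yields_three_points s u :
  (forall X r, (X, r) \in rules g -> K * size r <= M) ->
  yields s u -> three_points s u.
Proof.
move=> rulesM; elim=> {s u} [|l s w sw IHs|X r s u w Xr ru IHr sw IHs].
- by apply: three_points_short => //; apply: yields_nil.
- have lP := yields_terminal l (yields_nil g).
  by apply: (@three_points_cons _ _ [:: l]) => //; apply: three_points_short.
- apply: three_points_cons => //; first exact: yields_rule Xr ru.
  move=> a v w' b p1 p2 p3 _ /(spans_rule Xr).
  exact/IHr/rulesM/Xr.
Qed.

End ThreePoints.

Lemma geodesic_dist (x y z : vertex G) p : walk x p y -> size p = path_dist x y ->
  z \in x :: map ter p -> path_dist x z + path_dist z y = path_dist x y.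
Proof.
move=> xy sp /(walk_mem_split xy)[q [r [pE /path_dist_le xz /path_dist_le zy]]].
apply/eqP; rewrite eqn_leq path_dist_triangle andbT -sp pE size_cat.
exact: leq_add.
Qed.

Lemma dist_frontier_bounded (x0 : vertex G) : loop_language x0 = cfg_language g ->
  exists D, forall (v w : vertex G) p, path_dist x0 v = path_dist x0 w -> walk v p w ->
    all (fun z => path_dist x0 v <= path_dist x0 z) (v :: map ter p) ->
    path_dist v w <= D.
Proof.
move=> LE; have [K K_gt0 distK] := spans_symbol_bounded.
(* Covers every right-hand side; the successor also covers the start symbol taken alone. *)
pose M := K * (\max_(r <- rules g) size r.2).+1.
have rulesM X r : (X, r) \in rules g -> K * size r <= M.
  move=> Xr; rewrite leq_pmul2l // leqW //.
  exact: (@leq_bigmax_seq _ (rules g) predT (fun r => size r.2) _ Xr).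
(* As [m] has level at least that of [v], the level of [i] is at most [M] lower, so [i] is within
   [M] of [v] on the geodesic; likewise [j] and [w]. The path through [v], [i], [m], [j], [w] has
   four steps of length at most [M]. *)
exists (M + M + (M + M)) => v w p vw vpw /allP high.
have [p1 p1v sp1] := path_dist_walk x0 v.
have [p3 p3w sp3] := path_dist_walk w x0.
have loop q : walk x0 q x0 -> yields [:: inl (start g)] (map (@label A G) q).
  move=> q0; apply/cfg_derives_yields.
  have : loop_language x0 (map (@label A G) q) by exists q.
  by rewrite LE.
have span0 : spans [:: inl (start g)] x0 x0.
  move=> u /cfg_derives_yields uL; have : loop_language x0 u by rewrite LE.
  by move=> [q q0 <-]; exists q.
have /loop yP := walk_cat p1v (walk_cat vpw p3w).
have [||i [m [j [[ip1 mp jp3] im mj]]]] :=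
  yields_three_points K_gt0 distK rulesM yP _ span0 p1v vpw p3w.
- by rewrite leq_pmul2l.
- by [].
have := high m mp; have := geodesic_dist p1v sp1 ip1.
have := geodesic_dist p3w sp3 jp3.
have := path_dist_triangle i x0 m; have := path_dist_triangle j x0 m.
have := path_dist_triangle i v w; have := path_dist_triangle m i w.
have := path_dist_triangle j m w.
rewrite (path_dist_sym w x0) (path_dist_sym w j) (path_dist_sym j x0).
rewrite (path_dist_sym j m) (path_dist_sym v i).
lia.
Qed.

End Reads.

(** * The tree of cones *)

Section ConeTree.
Variables (G : cgraph) (x0 : vertex G).
Implicit Types (v w : vertex G) (e : edge G) (n : nat).
Local Notation lev := (path_dist x0).

Definition outside n : pred (edge G) :=
  fun e => (n <= lev (ini e)) && (n <= lev (ter e)).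

(* [v] and [w] lie on the same sphere around [x0], of radius [n] say, and in the
   same component of the complement of the open ball of radius [n]. *)
Definition same_cone : rel (vertex G) := fun v w =>
  `[< lev v = lev w /\ exists2 p, walk v p w & all (outside (lev v)) p >].

Fact same_cone_refl : reflexive same_cone.
Proof. by move=> v; apply/asboolP; split=> //; exists [::]; rewrite /=. Qed.

Fact same_cone_sym : symmetric same_cone.
Proof.
suff sub v w : same_cone v w -> same_cone w v.
  by move=> v w; apply/idP/idP; apply: sub.
move=> /asboolP[vw [p vpw op]]; apply/asboolP; split=> //.
exists (rev (map einv p)); first exact: walk_rev.
rewrite all_rev all_map -vw; apply: sub_all op => e.
by rewrite /= /outside ini_einv ter_einv andbC.
Qed.

Fact same_cone_trans : transitive same_cone.
Proof.
move=> w v z /asboolP[vw [p vpw op]] /asboolP[wz [q wqz oq]].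
apply/asboolP; rewrite vw; split=> //; exists (p ++ q); first exact: walk_cat vpw wqz.
by rewrite all_cat -{1}vw op oq.
Qed.

Definition same_cone_equiv :=
  EquivRel same_cone same_cone_refl same_cone_sym same_cone_trans.

Definition cone : choiceType := {eq_quot same_cone_equiv}%qT.
Definition cone_of v : cone := (\pi_{eq_quot same_cone_equiv} v)%qT.
Definition cone_repr (t : cone) : vertex G := repr (t : {eq_quot same_cone_equiv}%qT).

Lemma cone_reprK t : cone_of (cone_repr t) = t.
Proof. exact: reprK. Qed.

Lemma cone_ofP v w : reflect (cone_of v = cone_of w) (same_cone v w).
Proof. exact: (@eqmodP _ same_cone_equiv). Qed.

Definition cone_level t := lev (cone_repr t).

Lemma cone_level_of v : cone_level (cone_of v) = lev v.
Proof. by have /cone_ofP/asboolP[] := cone_reprK (cone_of v). Qed.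

Lemma descending_edge v : 0 < lev v ->
  exists2 e, ini e = v & (lev (ter e)).+1 = lev v.
Proof.
rewrite path_dist_sym; have [[|e p] /= + vp] := path_dist_walk v x0.
  by rewrite -vp.
move=> /andP[/eqP ev /path_dist_le ep] _; exists e => //.
have ee : walk v [:: e] (ter e) by rewrite /= ev !eqxx.
have := path_dist_triangle (ter e) v x0; have := path_dist_le ee.
rewrite (path_dist_sym x0) -vp /=; lia.
Qed.

(** The default [v] is taken only at level 0, where there is no lower neighbour. *)
Definition below v : vertex G :=
  xget v [set ter e | e in [set e | ini e = v /\ (lev (ter e)).+1 = lev v]]%classic.

Lemma belowP v : 0 < lev v ->
  exists e, [/\ ini e = v, ter e = below v & (lev (below v)).+1 = lev v].
Proof.
move=> /descending_edge[e ev le]; rewrite /below; case: xgetP => [_ _ [f [fv lf] <-]|].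
  by exists f.
by move=> /(_ (ter e))[]; exists e.
Qed.

Definition cone_parent (t : cone) : cone := cone_of (below (cone_repr t)).

Lemma cone_level_parent t : 0 < cone_level t ->
  (cone_level (cone_parent t)).+1 = cone_level t.
Proof. by move=> /belowP[e [_ _]]; rewrite cone_level_of. Qed.

(** The parent does not depend on the representative or the lower neighbour: go up from [below v] to
    [v], follow the walk inside the cone, then go down [e]; this stays outside the ball of radius
    one less. *)
Lemma cone_parent_of e : (lev (ter e)).+1 = lev (ini e) ->
  cone_parent (cone_of (ini e)) = cone_of (ter e).
Proof.
move=> le; have /cone_ofP/asboolP[] := cone_reprK (cone_of (ini e)).
rewrite /cone_parent; set v := cone_repr _ => lv [p vp op].
have [|f [fv ft lf]] := @belowP v; first by rewrite lv -le.
have lbt : lev (below v) = lev (ter e) by lia.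
apply/cone_ofP/asboolP; split=> //.
exists (einv f :: p ++ [:: e]).
  rewrite /= ini_einv ft eqxx ter_einv fv /=; apply: walk_cat vp _.
  by rewrite /= !eqxx.
rewrite /= all_cat /= /outside ini_einv ter_einv ft fv lbt lv -le.
rewrite !leqnn leqnSn !andbT; apply: sub_all op => h /andP[].
by rewrite lv -le => h1 h2; apply/andP; split; apply: ltnW.
Qed.

Lemma cone_root_uniq t t' : cone_level t = 0 -> cone_level t' = 0 -> t = t'.
Proof.
move=> /path_dist_eq0 xt /path_dist_eq0 xt'.
by rewrite -(cone_reprK t) -(cone_reprK t') -xt -xt'.
Qed.

Definition cone_tree : tree :=
  @Tree (CGraph (forest_connected cone_level_parent cone_root_uniq))
        (forest_acyclic cone_level_parent).

Lemma path_dist_cone_parent (t : cone) : 0 < cone_level t ->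
  path_dist (G := cone_tree) t (cone_parent t) <= 1.
Proof.
move=> t0; have [e [_ [te _]]] := parent_walks cone_parent t0.
exact: (@path_dist_le cone_tree _ _ [:: e]).
Qed.

(** The levels of the two ends differ by at most one; if they agree, [e] itself joins them within
    one cone. *)
Lemma cone_of_edge e :
  path_dist (G := cone_tree) (cone_of (ini e)) (cone_of (ter e)) <= 1.
Proof.
have down f : (lev (ter f)).+1 = lev (ini f) ->
    path_dist (G := cone_tree) (cone_of (ini f)) (cone_of (ter f)) <= 1.
  move=> lf; rewrite -(cone_parent_of lf); apply: path_dist_cone_parent.
  by rewrite cone_level_of -lf.
have ee : path_dist (ini e) (ter e) <= 1.
  by apply: (@path_dist_le _ _ _ [:: e]); rewrite /= !eqxx.
have := path_dist_triangle (ini e) x0 (ter e).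
have := path_dist_triangle (ter e) x0 (ini e).
rewrite (path_dist_sym (ter e)) => le1 le2.
have [lt|lt|eq_lev] := ltngtP (lev (ini e)) (lev (ter e)).
- rewrite path_dist_sym; have := down (einv e); rewrite ini_einv ter_einv; apply; lia.
- by apply: down; lia.
suff -> : cone_of (ini e) = cone_of (ter e) by rewrite path_distxx.
apply/cone_ofP/asboolP; split=> //; exists [:: e]; first by rewrite /= !eqxx.
by rewrite /= /outside eq_lev leqnn.
Qed.

Lemma cone_of_lipschitz v w :
  path_dist (G := cone_tree) (cone_of v) (cone_of w) <= path_dist v w.
Proof.
have [p vw <-] := path_dist_walk v w; elim: p v vw => [|e p IHp] v /=.
  by move=> /eqP->; rewrite path_distxx.
move=> /andP[/eqP <- /IHp pw].
apply: leq_trans (@path_dist_triangle cone_tree (cone_of (ter e)) _ _) _.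
by rewrite -add1n leq_add // cone_of_edge.
Qed.

(** A walk in the tree is lifted edge by edge: each lift costs one edge of [G] and a move of length
    at most [D] inside a cone. The last [D] is the move to [w] in the final cone. *)
Lemma dist_le_cone_dist D v w :
  (forall v w, same_cone v w -> path_dist v w <= D) ->
  path_dist v w <= D.+1 * path_dist (G := cone_tree) (cone_of v) (cone_of w) + D.
Proof.
move=> Dcone; have DP u u' : cone_of u = cone_of u' -> path_dist u u' <= D.
  by move=> /cone_ofP/Dcone.
have step z u : 0 < lev z -> cone_of u = cone_parent (cone_of z) ->
    path_dist z u <= D.+1.
  move=> /descending_edge[e <- le]; rewrite (cone_parent_of le) => /esym/DP teu.
  have ee : walk (ini e) [:: e] (ter e) by rewrite /= !eqxx.
  have := path_dist_triangle (ter e) (ini e) u; have := path_dist_le ee.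
  by rewrite /=; lia.
have [p vw <-] := @path_dist_walk cone_tree (cone_of v) (cone_of w).
elim: p v vw => [|e p IHp] v /=.
  by rewrite muln0 => /eqP/DP.
move=> /andP[/eqP ev pw].
have [u ue vu] : exists2 u,
    cone_of u = forest_ter cone_parent e & path_dist v u <= D.+1.
  case: e ev {pw} => [[t t0] []]; rewrite /= /forest_ini /forest_ter /= => ev.
    exists (below (cone_repr t)) => //; apply: step; last by rewrite -ev.
    by rewrite -cone_level_of -ev.
  exists (cone_repr t); first exact: cone_reprK.
  by rewrite path_dist_sym; apply: step; rewrite ?cone_reprK.
rewrite -ue in pw; apply: leq_trans (path_dist_triangle u v w) _.
by rewrite mulnS -addnA leq_add // IHp.
Qed.

End ConeTree.

Theorem proposition9 (R : realType) (A : finType) (G : inverse_digraph A)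
    (x0 : vertex G) (hL : context_free (loop_language x0)) :
  exists T : tree, quasi_isometric (path_space R G) (path_space R T).
Proof.
have [g LE] := hL; have [D distD] := dist_frontier_bounded LE.
have Dcone v w : same_cone x0 v w -> path_dist v w <= D.
  move=> /asboolP[vw [p vpw op]]; apply: distD vw vpw _; rewrite /= leqnn all_map.
  by apply: sub_all op => e /andP[].
exists (cone_tree x0), (cone_of x0).
(* Dividing [dist_le_cone_dist] by [D + 1] leaves the error [D / (D + 1) <= 1]; the projection is
   1-Lipschitz and onto, so 1 serves for the other constants. *)
exists (D.+1%:R^-1)%R, 1%R, 1%R, 1%R, 1%R; split.
- by rewrite invr_gt0 ltr0Sn ltr01.
- move=> x y; rewrite !mdist_path_space; apply/andP; split.
    rewrite lerBlDr mulrC ler_pdivrMr ?ltr0Sn // natr1 -natrM ler_nat.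
    by have := dist_le_cone_dist x y Dcone; lia.
  rewrite mul1r natr1 ler_nat; apply: leqW; exact: cone_of_lipschitz.
- move=> t; exists (cone_repr t); rewrite cone_reprK mdistxx; exact: ler01.
Qed.
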